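(* The direct limit of a sequence of Ramsey algebras need not be a Ramsey algebra: there exists a direct system $\mathcal{A}_0\to\mathcal{A}_1\to\mathcal{A}_2\to\cdots$, indexed by $\omega$, of algebras of a common language and homomorphisms between them, such that every $\mathcal{A}_n$ is a Ramsey algebra but the direct limit of the system is not a Ramsey algebra.
   Context: An algebra $\mathcal{A}=(A,\mathcal{F})$ consists of a set $A$ and a family $\mathcal{F}$ of finitary operations $f:A^n\to A$ on $A$. When $\mathcal{L}$ is a set of function symbols (a purely functional language), an algebra of the language $\mathcal{L}$ is an $\mathcal{L}$-structure, $\mathcal{F}$ being the family of interpretations of the symbols; direct limit is in the usual model-theoretic sense for $\mathcal{L}$-structures. An $n$-ary $f$ is an orderly composition of a family $\mathcal{G}$ of operations if there are a $k$-ary $g\in\mathcal{G}$ and $n_j$-ary $h_j\in\mathcal{G}$ ($1\le j\le k$) with $\sum_{j=1}^k n_j=n$ such that $f(x_1,\dots,x_n)=g(h_1(\bar x_1),\dots,h_k(\bar x_k))$, where $\bar x_1,\dots,\bar x_k$ are the consecutive blocks of $(x_1,\dots,x_n)$ of lengths $n_1,\dots,n_k$. The set $\mathrm{OT}(\mathcal{F})$ of orderly terms over $\mathcal{F}$ is the smallest collection of operations on $A$ that contains $\mathcal{F}\cup\{\mathrm{id}_A\}$ and is closed under orderly composition. For infinite sequences $\vec a,\vec b\in{}^\omega A$, $\vec a$ is a reduction of $\vec b$, written $\vec a\le_{\mathcal{F}}\vec b$, if there are orderly terms $f_j\in\mathrm{OT}(\mathcal{F})$ and finite subsequences $\vec b_j$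 of $\vec b$ ($j\in\omega$) such that $\vec a(j)=f_j(\vec b_j)$ for every $j$ and the concatenation $\vec b_0*\vec b_1*\cdots$ is a subsequence of $\vec b$. Put $\mathrm{FR}_{\mathcal{F}}(\vec b)=\{\vec a(0):\vec a\le_{\mathcal{F}}\vec b\}$. The algebra $(A,\mathcal{F})$ is a Ramsey algebra if for every $\vec b\in{}^\omega A$ and every $X\subseteq A$ there is $\vec a\le_{\mathcal{F}}\vec b$ such that $\mathrm{FR}_{\mathcal{F}}(\vec a)$ is either contained in $X$ or disjoint from $X$. *)

(* Defs.v *)
From HB Require Import structures.
From mathcomp Require Import all_boot.
From mathcomp Require Import boolp classical_sets.

Set Implicit Arguments.
Unset Strict Implicit.
Unset Printing Implicit Defensive.

Local Open Scope quotient_scope.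
Local Open Scope classical_set_scope.

Record operation (A : Type) := Operation {
  arity : nat;
  apply_op :> arity.-tuple A -> A
}.

Definition id_op (A : Type) : operation A :=
  @Operation A 1 (fun x => tnth x ord0).

(* The blocks of y are given as tuples [x j] whose concatenation is y. *)
Definition orderly_composition (A : Type) (G : set (operation A))
    (f : operation A) : Prop :=
  exists (g : operation A) (h : 'I_(arity g) -> operation A),
    [/\ G g, (forall j, G (h j)),
        arity f = (\sum_(j < arity g) arity (h j))%N
      & forall (y : (arity f).-tuple A) (x : forall j, (arity (h j)).-tuple A),
          tval y = flatten [seq tval (x j) | j <- enum 'I_(arity g)] ->
          f y = g [tuple h j (x j) | j < arity g]].

Definition orderly_closed (A : Type) (G : set (operation A)) : Prop :=
  orderly_composition G `<=` G.

Definition OT (A : Type) (F : set (operation A)) : set (operation A) :=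
  smallest (@orderly_closed A) (F `|` [set id_op A]).

(* [s j] is the tuple of positions in b from which the finite subsequence b_j
   is taken. That b_0 * b_1 * ... is a subsequence of b means that these
   positions, read consecutively, are strictly increasing; stating this on the
   initial parts also covers the case of a finite concatenation (all but
   finitely many b_j empty). *)
Definition reduction (A : Type) (F : set (operation A)) (a b : nat -> A)
    : Prop :=
  exists (f : nat -> operation A) (s : forall j, (arity (f j)).-tuple nat),
    [/\ forall j, OT F (f j),
        forall j, a j = f j (map_tuple b (s j))
      & forall N, sorted ltn (flatten [seq tval (s j) | j <- iota 0 N])].

Definition FR (A : Type) (F : set (operation A)) (b : nat -> A) : set A :=
  [set a 0 | a in [set a | reduction F a b]].

Definition ramsey (A : Type) (F : set (operation A)) : Prop :=
  forall (b : nat -> A) (X : set A),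
    exists2 a, reduction F a b & FR F a `<=` X \/ FR F a `&` X = set0.

Record language := Language {
  symbol : Type;
  symbol_arity : symbol -> nat
}.

Record algebra (L : language) := Algebra {
  carrier :> Type;
  interp : forall s : symbol L, (symbol_arity s).-tuple carrier -> carrier
}.
Arguments interp {L} a s _.

Definition operations (L : language) (A : algebra L)
    : set (operation (carrier A)) :=
  [set Operation (interp A s) | s in [set: symbol L]].
Arguments operations {L} A _.

Definition ramsey_algebra (L : language) (A : algebra L) : Prop :=
  ramsey (operations A).

Definition homomorphism (L : language) (A B : algebra L) (phi : A -> B)
    : Prop :=
  forall (s : symbol L) (x : (symbol_arity s).-tuple A),
    phi (interp A s x) = interp B s (map_tuple phi x).

Record direct_system (L : language) := DirectSystem {
  obj :> nat -> algebra L;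
  mor : forall m n : nat, m <= n -> obj m -> obj n;
  mor_hom : forall m n (le_mn : m <= n), homomorphism (mor le_mn);
  mor_id : forall n (le_nn : n <= n) (x : obj n), mor le_nn x = x;
  mor_comp : forall m n k (le_mn : m <= n) (le_nk : n <= k) (le_mk : m <= k)
    (x : obj m), mor le_nk (mor le_mn x) = mor le_mk x
}.
Arguments mor {L} d {m n} _ _.

Definition sum_carrier (L : language) (D : direct_system L) : Type :=
  {classic {n : nat & D n}}.
HB.instance Definition _ (L : language) (D : direct_system L) :=
  Choice.copy (sum_carrier D) {classic {n : nat & D n}}.

Definition in_sum (L : language) (D : direct_system L) (n : nat) (x : D n)
    : sum_carrier D :=
  existT _ n x.

Definition limit_rel (L : language) (D : direct_system L) :
    rel (sum_carrier D) :=
  fun u v => `[< exists k (le_uk : tag u <= k) (le_vk : tag v <= k),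
    mor D le_uk (tagged u) = mor D le_vk (tagged v) >].

Lemma mor_eq_widen (L : language) (D : direct_system L) m n k l
    (le_mk : m <= k) (le_nk : n <= k) (le_ml : m <= l) (le_nl : n <= l)
    (x : D m) (y : D n) :
  k <= l -> mor D le_mk x = mor D le_nk y -> mor D le_ml x = mor D le_nl y.
Proof.
by move=> le_kl /(congr1 (mor D le_kl)); rewrite !(mor_comp _ le_kl).
Qed.

Lemma limit_rel_refl (L : language) (D : direct_system L) :
  reflexive (@limit_rel L D).
Proof. by move=> u; apply/asboolP; exists (tag u), (leqnn _), (leqnn _). Qed.

Lemma limit_rel_sym (L : language) (D : direct_system L) :
  symmetric (@limit_rel L D).
Proof.
by move=> u v; apply/asboolP/asboolP => -[k [p [q e]]]; exists k, q, p.
Qed.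

Lemma limit_rel_trans (L : language) (D : direct_system L) :
  transitive (@limit_rel L D).
Proof.
move=> v u w /asboolP[k [uk [vk euv]]] /asboolP[l [vl [wl evw]]].
apply/asboolP; have kK := leq_maxl k l; have lK := leq_maxr k l.
exists (maxn k l), (leq_trans uk kK), (leq_trans wl lK).
transitivity (mor D (leq_trans vk kK) (tagged v)).
  exact: mor_eq_widen kK euv.
exact: mor_eq_widen lK evw.
Qed.

Canonical limit_equiv (L : language) (D : direct_system L) :=
  EquivRel (@limit_rel L D) (@limit_rel_refl L D) (@limit_rel_sym L D)
    (@limit_rel_trans L D).

Definition limit_carrier (L : language) (D : direct_system L) : Type :=
  {eq_quot (limit_equiv D)}.

Definition limit_in (L : language) (D : direct_system L) (n : nat) (x : D n) :
    limit_carrier D :=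
  \pi_({eq_quot (limit_equiv D)}) (in_sum x).

Definition limit_repr (L : language) (D : direct_system L)
    (c : limit_carrier D) : {n : nat & D n} :=
  repr (c : {eq_quot (limit_equiv D)}).

(* Representatives of the arguments are moved to a common stage, where the
   symbol is interpreted; [limit_in_hom] shows that the choice of
   representatives and of the stage is immaterial. *)
Definition limit_interp (L : language) (D : direct_system L) (s : symbol L)
    (c : (symbol_arity s).-tuple (limit_carrier D)) : limit_carrier D :=
  let stage i := tag (limit_repr (tnth c i)) in
  limit_in (interp (D (\max_i stage i)) s
    [tuple mor D (leq_bigmax (F := stage) i) (tagged (limit_repr (tnth c i)))
       | i < symbol_arity s]).

Definition direct_limit (L : language) (D : direct_system L) : algebra L :=
  Algebra (@limit_interp L D).

Lemma limit_in_eq (L : language) (D : direct_system L) m n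
    (x : D m) (y : D n) :
  limit_in x = limit_in y <->
  exists k (le_mk : m <= k) (le_nk : n <= k), mor D le_mk x = mor D le_nk y.
Proof.
split=> [/eqquotP/asboolP //|e].
by apply/eqquotP/asboolP.
Qed.

Lemma limit_reprK (L : language) (D : direct_system L) (c : limit_carrier D) :
  limit_in (tagged (limit_repr c)) = c.
Proof.
rewrite /limit_in (_ : in_sum _ = limit_repr c); first exact: reprK.
by rewrite /in_sum; case: (limit_repr c).
Qed.

Lemma limit_in_mor (L : language) (D : direct_system L) m n (le_mn : m <= n)
    (x : D m) :
  limit_in (mor D le_mn x) = limit_in x.
Proof.
by apply/limit_in_eq; exists n, (leqnn n), le_mn; rewrite mor_id.
Qed.

Lemma limit_in_hom (L : language) (D : direct_system L) n :
  @homomorphism L (D n) (direct_limit D) (@limit_in L D n).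
Proof.
move=> s x; rewrite /= /limit_interp.
set c := map_tuple _ x; set stage := fun i => tag (limit_repr (tnth c i)).
have eqi i : exists k, forall l (le_nl : n <= l) (le_il : stage i <= l),
    k <= l -> mor D le_nl (tnth x i)
            = mor D le_il (tagged (limit_repr (tnth c i))).
  have /limit_in_eq[k [p [q e]]] :
      limit_in (tnth x i) = limit_in (tagged (limit_repr (tnth c i))).
    by rewrite limit_reprK tnth_map.
  by exists k => l nl il kl; exact: mor_eq_widen kl e.
have [K KP] := choice eqi.
pose M := \max_i stage i; pose l := maxn (maxn n M) (\max_i K i).
have le_nl : n <= l by rewrite /l !leq_max leqnn.
have le_Ml : M <= l by rewrite /l !leq_max leqnn orbT.
apply/limit_in_eq; exists l, le_nl, le_Ml; rewrite !mor_hom; congr interp.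
apply: eq_from_tnth => i; rewrite !tnth_map tnth_ord_tuple.
have le_il : stage i <= l by apply: leq_trans le_Ml; exact: leq_bigmax.
rewrite (mor_comp _ _ le_il); apply: KP.
by rewrite /l leq_max leq_bigmax orbT.
Qed.

(* Main.v *)
(* Take the pairs (level, colour) in N x bool with the binary operation
     (n, c) * (m, d) = (m, ~~ c) if n < m, and (n, c) otherwise.
   Every element is idempotent, and the elements of level at most n form a
   finite subalgebra, in which every sequence has a constant subsequence: this
   is a reduction whose set FR is a singleton.  In the union of these
   subalgebras orderly terms take the maximum of the levels of their arguments,
   so any reduction a of the sequence of the (i, true) has a(0) of smaller level
   than a(1); then a(0) and a(0) * a(1) both lie in FR(a), with different
   colours. *)

Require Import Defs.
From mathcomp Require Import all_boot.
From mathcomp Require Import boolp classical_sets.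

Set Implicit Arguments.
Unset Strict Implicit.
Unset Printing Implicit Defensive.

Local Open Scope classical_set_scope.

(** Cutting [y] with [reshape] gives the blocks. They are needed because [orderly_composition] only
    says what happens for blocks that are already given. *)
Lemma flatten_tuples (A : Type) (k : nat) (n : 'I_k -> nat) (y : seq A) :
  size y = \sum_(j < k) n j ->
  exists x : forall j, (n j).-tuple A,
    y = flatten [seq tval (x j) | j <- enum 'I_k].
Proof.
move=> sz_y; pose sh := [seq n j | j <- enum 'I_k].
have sumn_sh : sumn sh = size y.
  by rewrite sz_y sumnE big_map big_enum.
have sz_sh : size sh = k by rewrite size_map size_enum_ord.
have sz_block (j : 'I_k) : size (nth [::] (reshape sh y) j) == n j.
  rewrite -(nth_map _ 0 size) ?size_reshape ?sz_sh //.
  rewrite -/(shape _) reshapeKl ?sumn_sh // (nth_map j) ?size_enum_ord //.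
  by rewrite nth_ord_enum.
exists (fun j => Tuple (sz_block j)).
rewrite -[LHS](@reshapeKr _ sh) ?sumn_sh //; congr flatten.
apply: (@eq_from_nth _ [::]); first by rewrite size_reshape !size_map.
move=> i; rewrite size_reshape sz_sh => lt_ik.
rewrite (nth_map (Ordinal lt_ik)) ?size_enum_ord //=.
by rewrite (nth_enum_ord _ lt_ik).
Qed.

(** [P] is itself one of the closed families that [OT F] is smallest among. In the composition case
    the blocks of each [y] are handed over by [flatten_tuples]. *)
Lemma OT_ind (A : Type) (F P : set (operation A)) :
  F `<=` P -> P (@id_op A) ->
  (forall (f g : operation A) (h : 'I_(arity g) -> operation A),
     P g -> (forall j, P (h j)) -> arity f = \sum_(j < arity g) arity (h j) ->
     (forall y : (arity f).-tuple A,
        exists2 x : forall j, (arity (h j)).-tuple A,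
        tval y = flatten [seq tval (x j) | j <- enum 'I_(arity g)] &
        f y = g [tuple h j (x j) | j < arity g]) ->
     P f) ->
  OT F `<=` P.
Proof.
move=> FP Pid Pcomp f; apply; split; last first.
  by move=> g [/FP|->].
move=> {}f [g [h [Pg Ph far fE]]]; apply: (Pcomp f g h) => // y.
have [|x yE] := @flatten_tuples A (arity g) (fun j => arity (h j)) y.
  by rewrite size_tuple far.
by exists x => //; apply: fE.
Qed.

Lemma OT_id (A : Type) (F : set (operation A)) : OT F (@id_op A).
Proof. by move=> G [_]; apply; right. Qed.

Lemma OT_base (A : Type) (F : set (operation A)) : F `<=` OT F.
Proof. by move=> f Ff G [_]; apply; left. Qed.

Lemma OT_arity_gt0 (A : Type) (F : set (operation A)) :
  (forall f, F f -> 0 < arity f) -> forall f, OT F f -> 0 < arity f.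
Proof.
move=> F_gt0; apply: OT_ind => // f g h g_gt0 h_gt0 far _.
by rewrite far (bigD1 (Ordinal g_gt0)) //= addn_gt0 h_gt0.
Qed.

(** With [P := pred1 x], idempotence passes from [F] to all orderly terms. *)
Lemma OT_all (A : Type) (F : set (operation A)) (P : pred A) :
  (forall f, F f -> forall y : (arity f).-tuple A, all P y -> P (f y)) ->
  forall f, OT F f -> forall y : (arity f).-tuple A, all P y -> P (f y).
Proof.
move=> FP; apply: OT_ind => // [y /all_tnthP|f g h gP hP _ fE y]; first exact.
have [x -> ->] := fE y.
have -> : all P (flatten [seq tval (x j) | j <- enum 'I_(arity g)])
    = all (fun j => all P (x j)) (enum 'I_(arity g)).
  by elim: (enum _) => //= j r <-; rewrite all_cat.
move=> /allP xP; apply: gP; apply/all_tnthP => j; rewrite tnth_mktuple.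
by apply: hP; apply: xP; rewrite mem_enum.
Qed.

(** The maximum over a concatenation is the maximum of the maxima of its blocks. *)
Lemma OT_max (A : Type) (F : set (operation A)) (lev : A -> nat) :
  (forall f, F f -> forall y, lev (f y) = \max_(c <- y) lev c) ->
  forall f, OT F f -> forall y, lev (f y) = \max_(c <- y) lev c.
Proof.
move=> Fmax; apply: OT_ind => // [y|f g h gmax hmax _ fE y].
  by rewrite big_tuple big_ord1.
have [x -> ->] := fE y; rewrite gmax big_flatten big_map big_tuple big_enum.
by apply: eq_bigr => j _; rewrite tnth_mktuple hmax.
Qed.

(** The term becomes entry 0 of a reduction whose later entries are single terms of [b], taken
    beyond all positions in [t]. *)
Lemma FR_term (A : Type) (F : set (operation A)) (b : nat -> A)
    (f : operation A) (t : (arity f).-tuple nat) :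
  OT F f -> sorted ltn t -> FR F b (f (map_tuple b t)).
Proof.
move=> Ff t_sorted; pose m := \max_(i <- t) i.
pose fs j := if j is 0 then f else @id_op A.
pose s j : (arity (fs j)).-tuple nat :=
  if j is i.+1 return (arity (fs j)).-tuple nat then [tuple (m + i).+1] else t.
exists (fun j => fs j (map_tuple b (s j))) => //.
exists fs, s; split=> // [[|j] //|[|N] //]; first exact: OT_id.
(* After [t] come the positions [m + 1], ..., [m + N], all above the maximum [m] of [t]. *)
rewrite /= (_ : flatten _ = [seq m + i | i <- iota 1 N]); last first.
  by elim: N 0 => //= N IHN k; rewrite IHN addnS.
rewrite sorted_pairwise; last exact: ltn_trans.
rewrite pairwise_cat -!sorted_pairwise ?t_sorted /=; try exact: ltn_trans.
apply/andP; split; last first.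
  apply: (homo_sorted (e := ltn)); last exact: iota_ltn_sorted.
  by move=> i j /=; rewrite ltn_add2l.
apply/allrelP => i _ it /mapP[j + ->]; rewrite mem_iota => /andP[j_gt0 _].
change (i < m + j); rewrite -addn1 leq_add //.
exact: (leq_bigmax_seq (F := id) i it).
Qed.

Lemma constant_subsequence (T : finType) (b : nat -> T) :
  exists (x : T) (e : nat -> nat),
    {homo e : i j / i < j} /\ forall i, b (e i) = x.
Proof.
have [x x_inf] : exists x, forall n, exists m, n <= m /\ b m = x.
  apply: contrapT => /forallNP fin_b.
  have /choice[N NP] x : exists n, forall m, n <= m -> b m <> x.
    have /existsNP[n /forallNP nP] := fin_b x.
    by exists n => m le_nm bm; apply: (nP m).
  (* From [m] on no value occurs any more, yet [b m] is a value. *)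
  pose m := \max_x N x.
  exact: (NP (b m) m (leq_bigmax (F := N) (b m))).
have [k kP] := choice x_inf.
(* [k n] is an occurrence of [x] at or after [n]; the successor in [(e j).+1] makes [e] strictly
   increasing. *)
pose e := fix e i := if i is j.+1 then k (e j).+1 else k 0.
exists x, e; split; last by case=> [|i]; exact: (kP _).2.
by apply: (homo_ltn ltn_trans) => i; have [] := kP (e i).+1.
Qed.

Lemma finite_idempotent_ramsey (T : finType) (F : set (operation T)) :
  (forall f, F f ->
     forall x (y : (arity f).-tuple T), all (pred1 x) y -> f y = x) ->
  ramsey F.
Proof.
move=> Fidem b X; have [x [e [e_mono be]]] := constant_subsequence b.
exists (fun=> x).
  exists (fun=> @id_op T), (fun j => [tuple e j]); split=> [j|j|N].
  - exact: OT_id.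
  - by rewrite /= tnth_map be.
  - rewrite (_ : flatten _ = map e (iota 0 N)).
      by apply: (homo_sorted e_mono); exact: iota_ltn_sorted.
    by elim: (iota 0 N) => //= i s ->.
have FRx c : FR F (fun=> x) c -> c = x.
  case=> a [f [s [fF aE _]]] <-; rewrite aE; apply/eqP.
  apply: (OT_all (P := pred1 x) _ (fF 0)).
    by move=> g Fg y yx; apply/eqP/Fidem.
  by rewrite all_map; apply/allP => i _ /=.
have [Xx|nXx] := pselect (X x); first by left=> c /FRx ->.
by right; apply/seteqP; split=> // c [/FRx ->].
Qed.

Definition binary_language : language := Language (fun _ : unit => 2).

Definition flip_stage (n : nat) : algebra binary_language :=
  @Algebra binary_language ('I_n.+1 * bool)%type (fun _ x =>
    let u := tnth x ord0 in let v := tnth x ord_max in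
    if u.1 < v.1 then (v.1, ~~ u.2) else u).

Definition flip_widen (m n : nat) (le_mn : m <= n) (u : flip_stage m) :
    flip_stage n :=
  (widen_ord (le_mn : m.+1 <= n.+1) u.1, u.2).

Lemma flip_widen_hom (m n : nat) (le_mn : m <= n) :
  homomorphism (flip_widen le_mn).
Proof. by move=> s x; rewrite /= !tnth_map /=; case: ifP. Qed.

Lemma flip_widen_id (n : nat) (le_nn : n <= n) (u : flip_stage n) :
  flip_widen le_nn u = u.
Proof. by case: u => i c; congr pair; apply: val_inj. Qed.

Lemma flip_widen_comp (m n k : nat) (le_mn : m <= n) (le_nk : n <= k)
    (le_mk : m <= k) (u : flip_stage m) :
  flip_widen le_nk (flip_widen le_mn u) = flip_widen le_mk u.
Proof. by congr pair; apply: val_inj. Qed.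

Definition flip_system : direct_system binary_language :=
  DirectSystem flip_widen_hom flip_widen_id flip_widen_comp.

Lemma flip_stage_ramsey (n : nat) : ramsey_algebra (flip_stage n).
Proof.
apply: (@finite_idempotent_ramsey ('I_n.+1 * bool)%type).
move=> _ [s _ <-] x y /all_tnthP yx /=.
by rewrite (eqP (yx ord0)) (eqP (yx ord_max)) ltnn.
Qed.

Definition flip_limit : algebra binary_language := direct_limit flip_system.

Definition level (c : flip_limit) : nat :=
  (tagged (limit_repr (D := flip_system) c)).1.

Definition colour (c : flip_limit) : bool :=
  (tagged (limit_repr (D := flip_system) c)).2.

(** [level] and [colour] read off a chosen representative; since [flip_widen] keeps both
    coordinates, every representative gives the same values. *)
Lemma limit_in_level_colour (n : nat) (u : flip_system n) :
  level (limit_in u) = u.1 /\ colour (limit_in u) = u.2.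
Proof.
have /limit_in_eq[k [p [q [e1 e2]]]] := limit_reprK (limit_in u).
by split=> //; exact: e1.
Qed.

Lemma level_colour_interp (s : symbol binary_language)
    (x : 2.-tuple flip_limit) :
  let u := tnth x ord0 in let v := tnth x ord_max in
  let w := interp flip_limit s x in
  level w = maxn (level u) (level v) /\
  colour w = (level u < level v) (+) colour u.
Proof.
move=> u v w; rewrite /w /= /limit_interp.
rewrite [level _](limit_in_level_colour _).1.
rewrite [colour _](limit_in_level_colour _).2.
rewrite /= !tnth_mktuple /= -/(level _) -/(level _) -/(colour _).
by rewrite /maxn; case: ifP.
Qed.

Lemma flip_limit_not_ramsey : ~ ramsey_algebra flip_limit.
Proof.
(* [ord_max] in ['I_i.+1] has value [i], so [b i] has level [i]. *)
pose b i : flip_limit := @limit_in _ flip_system i (ord_max, true).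
move=> /(_ b [set c | colour c]) [a [f [s [fOT aE s_sorted]]] homog].
(* This makes the position blocks [s 0] and [s 1] nonempty; an empty block would give no strict
   inequality of levels. *)
have arity_gt0 g : OT (operations flip_limit) g -> 0 < arity g.
  by apply: OT_arity_gt0 => _ [t _ <-].
have level_term g : OT (operations flip_limit) g ->
    forall y, level (g y) = \max_(c <- y) level c.
  apply: OT_max => _ [t _ <-] y; have [-> _] := level_colour_interp t y.
  rewrite big_tuple big_ord_recl big_ord1; congr (maxn _ (level (tnth y _))).
  exact: val_inj.
have level_a j : level (a j) = \max_(i <- s j) i.
  rewrite aE level_term //= big_map; apply: eq_bigr => i _.
  by have [] := limit_in_level_colour (n := i) (ord_max, true).
have lt_a01 : level (a 0) < level (a 1).
  have /= := s_sorted 2; rewrite cats0 sorted_pairwise; last exact: ltn_trans.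
  rewrite pairwise_cat => /and3P[/allrelP lt_s01 _ _]; rewrite !level_a.
  have i1 := mem_tnth (Ordinal (arity_gt0 _ (fOT 1))) (s 1).
  apply: leq_trans (leq_bigmax_seq (F := id) _ i1 isT).
  have i0 := mem_tnth (Ordinal (arity_gt0 _ (fOT 0))) (s 0).
  (* The default value 0 of the maximum must also lie below the first position in [s 1]; any
     position in [s 0] witnesses this. *)
  rewrite big_seq; elim/big_ind: _ => [|m n m_lt n_lt|i si].
  - exact: leq_ltn_trans (leq0n _) (lt_s01 _ _ i0 i1).
  - by rewrite gtn_max m_lt.
  - exact: lt_s01 si i1.
pose star := Operation (interp flip_limit tt).
have FR0 : FR (operations flip_limit) a (a 0).
  exact: (@FR_term _ _ a (@id_op _) [tuple 0] (@OT_id _ _)).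
have FR1 : FR (operations flip_limit) a (star (map_tuple a [tuple 0; 1])).
  by apply: (@FR_term _ _ a star [tuple 0; 1]) => //; apply: OT_base; exists tt.
have [_] := level_colour_interp tt (map_tuple a [tuple 0; 1]).
rewrite !tnth_map /= lt_a01 /= => colour_star.
(* [a 0] and [star] of [a 0], [a 1] have opposite colours: inclusion would make both [true],
   disjointness both [false]. *)
case: homog => [sub|disj].
  have /= := sub _ FR1; rewrite colour_star.
  by have /= -> := sub _ FR0.
have not_both c : FR (operations flip_limit) a c -> ~~ colour c.
  by move=> FRc; apply/negP => col; have : set0 c by rewrite -disj.
by have := not_both _ FR1; rewrite /= colour_star not_both.
Qed.

Theorem theorem5p8 :
  exists (L : language) (D : direct_system L),
    (forall n : nat, ramsey_algebra (D n)) /\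
    ~ ramsey_algebra (direct_limit D).
Proof.
exists binary_language, flip_system.
by split; [exact: flip_stage_ramsey | exact: flip_limit_not_ramsey].
Qed.
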